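(* Assume exactness and $\mathbf{A}\neq0$. Let $x^0,x^1\in\mathbb{R}^n$ satisfy $x^0-x^1\in\mathrm{Range}(\mathbf{B}^{-1}\mathbf{A}^\top)$, and let $\{x^k\}$ be generated by $$x^{k+1}=x^k-\omega\nabla f_{\mathbf{S}_k}(x^k)+\beta(x^k-x^{k-1}),\qquad k\ge1,$$ with $0<\omega\le 1/\lambda_{\max}$ and $(1-\sqrt{\omega\lambda_{\min}^+})^2<\beta<1$. Let $x^*=\Pi_{\mathcal{L},\mathbf{B}}(x^0)$. Then there is a constant $C>0$ such that $$\big\|\mathbb{E}[x^k-x^*]\big\|_{\mathbf{B}}^2\le\beta^k C\qquad\text{for all }k\ge0.$$ In particular, the hypotheses on $(\omega,\beta)$ (and hence this bound) hold for (i) $\omega=1$, $\beta=(1-\sqrt{0.99\,\lambda_{\min}^+})^2$, and for (ii) $\omega=1/\lambda_{\max}$, $\beta=\big(1-\sqrt{0.99\,\lambda_{\min}^+/\lambda_{\max}}\big)^2$.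
   Context: Let $\mathbf{A}\in\mathbb{R}^{m\times n}$ and $b\in\mathbb{R}^m$ be such that the linear system $\mathbf{A}x=b$ is consistent, and let $\mathcal{L}=\{x\in\mathbb{R}^n:\mathbf{A}x=b\}$. Let $\mathbf{B}\in\mathbb{R}^{n\times n}$ be symmetric positive definite, $\langle x,y\rangle_{\mathbf{B}}=x^\top\mathbf{B}y$, $\|x\|_{\mathbf{B}}=\sqrt{x^\top\mathbf{B}x}$, and $\Pi_{\mathcal{L},\mathbf{B}}(x)=\arg\min_{x'\in\mathcal{L}}\|x'-x\|_{\mathbf{B}}$. Let $\mathcal{D}$ be a probability distribution over random real matrices $\mathbf{S}$ with $m$ rows (any number of columns). For $\mathbf{S}\sim\mathcal{D}$ set $\mathbf{H}=\mathbf{S}(\mathbf{S}^\top\mathbf{A}\mathbf{B}^{-1}\mathbf{A}^\top\mathbf{S})^\dagger\mathbf{S}^\top$ ($\dagger$ denotes the Moore–Penrose pseudoinverse) and $\mathbf{Z}=\mathbf{A}^\top\mathbf{H}\mathbf{A}$; $\mathbb{E}[\mathbf{Z}]$ is assumed finite. Define $f_{\mathbf{S}}(x)=\tfrac12(\mathbf{A}x-b)^\top\mathbf{H}(\mathbf{A}x-b)$ and $\nabla f_{\mathbf{S}}(x)=\mathbf{B}^{-1}\mathbf{A}^\top\mathbf{H}(\mathbf{A}x-b)$ (the gradient of $f_{\mathbf{S}}$ with respect to $\langle\cdot,\cdot\rangle_{\mathbf{B}}$). Let $\mathbf{W}=\mathbf{B}^{-1/2}\mathbb{E}[\mathbf{Z}]\mathbf{B}^{-1/2}$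 (its eigenvalues lie in $[0,1]$); $\lambda_{\max}$ is its largest eigenvalue and $\lambda_{\min}^+$ its smallest nonzero eigenvalue. Exactness means $\mathrm{Null}(\mathbb{E}[\mathbf{Z}])=\mathrm{Null}(\mathbf{A})$. The matrices $\mathbf{S}_k$ are drawn i.i.d. from $\mathcal{D}$, independently of everything else. *)

(* Defs.v *)
From HB Require Import structures.
From mathcomp Require Import all_boot all_order all_algebra.
From mathcomp Require Import all_classical all_reals all_analysis.

Set Implicit Arguments.
Unset Strict Implicit.
Unset Printing Implicit Defensive.

Import Order.TTheory GRing.Theory Num.Theory.
Local Open Scope ring_scope.
Local Open Scope classical_set_scope.

(* Moore--Penrose pseudoinverse: the (unique) X satisfying the four Penrose
   equations (it always exists over the reals; the default 0 is never used). *)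
Definition pinv (R : realType) (p q : nat) (M : 'M[R]_(p, q)) : 'M[R]_(q, p) :=
  xget 0 [set X : 'M[R]_(q, p) |
    [/\ M *m X *m M = M, X *m M *m X = X,
        (M *m X)^T = M *m X & (X *m M)^T = X *m M]].

Definition spd (R : realType) (n : nat) (B : 'M[R]_n) : Prop :=
  B^T = B /\ forall v : 'cV[R]_n, v != 0 -> 0 < (v^T *m B *m v) 0 0.

Definition psd_sqrt (R : realType) (n : nat) (M : 'M[R]_n) : 'M[R]_n :=
  xget 0 [set X : 'M[R]_n |
    [/\ X^T = X, (forall v : 'cV[R]_n, 0 <= (v^T *m X *m v) 0 0) & X *m X = M]].

Definition bnorm2 (R : realType) (n : nat) (B : 'M[R]_n) (v : 'cV[R]_n) : R :=
  (v^T *m B *m v) 0 0.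
Definition bnorm (R : realType) (n : nat) (B : 'M[R]_n) (v : 'cV[R]_n) : R :=
  Num.sqrt (bnorm2 B v).

Definition SkRaw (R : realType) (m : nat) := {q : nat & 'M[R]_(m, q)}.
HB.instance Definition _ (R : realType) (m : nat) :=
  Choice.on (SkRaw R m).
HB.instance Definition _ (R : realType) (m : nat) :=
  isPointed.Build (SkRaw R m) (existT (fun q => 'M[R]_(m, q)) 0%N 0).

Definition sk_entry (R : realType) (m : nat) (s : SkRaw R m) (i j : nat) : R :=
  let: existT q M := s in
  match (insub i : option 'I_m), (insub j : option 'I_q) with
  | Some i', Some j' => M i' j'
  | _, _ => 0
  end.

(* generators of the natural (Borel) sigma-algebra on the disjoint union of
   the spaces R^{m x q}: "S has q columns" and "entry (i,j) lies in a Borel set" *)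
Definition sk_gen (R : realType) (m : nat) : set (set (SkRaw R m)) :=
  [set E | (exists q : nat, E = [set s | projT1 s = q]) \/
           (exists (i j : nat) (U : set R), measurable U /\
               E = [set s | U (sk_entry s i j)])].

Definition Sk (R : realType) (m : nat) := g_sigma_algebraType (@sk_gen R m).

Definition Hmat (R : realType) (m n : nat) (A : 'M[R]_(m, n)) (B : 'M[R]_n)
  (s : Sk R m) : 'M[R]_m :=
  let: existT q Sm := s in
  Sm *m pinv (Sm^T *m A *m invmx B *m A^T *m Sm) *m Sm^T.

Definition Zmat (R : realType) (m n : nat) (A : 'M[R]_(m, n)) (B : 'M[R]_n)
  (s : Sk R m) : 'M[R]_n := A^T *m Hmat A B s *m A.

Definition EZ (R : realType) (m n : nat) (A : 'M[R]_(m, n)) (B : 'M[R]_n)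
  (D : probability (Sk R m) R) : 'M[R]_n :=
  \matrix_(i, j) fine (\int[D]_s ((Zmat A B s i j)%:E))%E.

Definition Wmat (R : realType) (m n : nat) (A : 'M[R]_(m, n)) (B : 'M[R]_n)
  (D : probability (Sk R m) R) : 'M[R]_n :=
  invmx (psd_sqrt B) *m EZ A B D *m invmx (psd_sqrt B).

(* gradient of f_S w.r.t. <.,.>_B *)
Definition gradf (R : realType) (m n : nat) (A : 'M[R]_(m, n)) (b : 'cV[R]_m)
  (B : 'M[R]_n) (s : Sk R m) (x : 'cV[R]_n) : 'cV[R]_n :=
  invmx B *m A^T *m Hmat A B s *m (A *m x - b).

(* heavy-ball iterates: hb_pair k = (x^k, x^{k+1}), with
   x^{k+1} = x^k - om * grad f_{S_k}(x^k) + beta (x^k - x^{k-1}), k >= 1 *)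
Fixpoint hb_pair (R : realType) (m n : nat) (A : 'M[R]_(m, n)) (b : 'cV[R]_m)
  (B : 'M[R]_n) (T : Type) (Sq : nat -> T -> Sk R m) (om beta : R)
  (x0 x1 : 'cV[R]_n) (k : nat) (w : T) : 'cV[R]_n * 'cV[R]_n :=
  match k with
  | 0%N => (x0, x1)
  | k'.+1 =>
      let: (u, v) := hb_pair A b B Sq om beta x0 x1 k' w in
      (v, v - om *: gradf A b B (Sq k w) v + beta *: (v - u))
  end.

Definition hb_iter (R : realType) (m n : nat) (A : 'M[R]_(m, n)) (b : 'cV[R]_m)
  (B : 'M[R]_n) (T : Type) (Sq : nat -> T -> Sk R m) (om beta : R)
  (x0 x1 : 'cV[R]_n) (k : nat) (w : T) : 'cV[R]_n :=
  (hb_pair A b B Sq om beta x0 x1 k w).1.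

Definition Evec (d : measure_display) (T : measurableType d) (R : realType)
  (P : probability T R) (n : nat) (X : T -> 'cV[R]_n) : 'cV[R]_n :=
  \col_i fine ('E_P[fun w => X w i ord0])%E.

Definition iid_with_law (d : measure_display) (T : measurableType d)
  (R : realType) (P : probability T R) (m : nat) (D : probability (Sk R m) R)
  (Sq : nat -> T -> Sk R m) : Prop :=
  [/\ (forall k, measurable_fun setT (Sq k)),
      (forall k (E : set (Sk R m)), measurable E -> P (Sq k @^-1` E) = D E) &
      (forall (I : seq nat) (E : nat -> set (Sk R m)), uniq I ->
         (forall i, measurable (E i)) ->
         P (\bigcap_(i in [set` I]) (Sq i @^-1` E i)) =
         (\prod_(i <- I) P (Sq i @^-1` E i))%E)].

Definition params_ok (R : realType) (lmax lminp om beta : R) : Prop :=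
  [/\ 0 < om, om <= lmax^-1,
      (1 - Num.sqrt (om * lminp)) ^+ 2 < beta & beta < 1].

(* Main.v *)
(* Write e_k for the mean of x^k - xstar.  Since S_k is independent of the
   history x^0, ..., x^k, the means satisfy the deterministic recursion
     e_(k+1) = (1 + beta) e_k - om B^-1 E[Z] e_k - beta e_(k-1),
   which in the coordinates y = B^(1/2) e reads
     y_(k+1) = M y_k - beta y_(k-1),   M = (1 + beta) I - om W.
   By exactness and the assumptions on x^0 and x^1 all y_k lie in Range(W).
   The form E_k = |y_(k+1)|^2 - <y_(k+1), M y_k> + beta |y_k|^2 satisfies
   E_(k+1) = beta E_k, and completing the square gives
   E_k >= <y_k, (beta - M^2/4) y_k>.  For a nonzero eigenvalue a of W,
     beta - (1 + beta - om a)^2 / 4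
       = (om a - (1 - sqrt beta)^2) ((1 + sqrt beta)^2 - om a) / 4
   is bounded below by a positive constant, because
   (1 - sqrt beta)^2 < om lminp <= om a <= 1 < (1 + sqrt beta)^2.
   Hence E_k controls |y_k|^2. *)

Require Import Defs.
From HB Require Import structures.
From mathcomp Require Import all_boot all_order all_algebra.
From mathcomp Require Import all_classical all_reals all_analysis.
From mathcomp Require Import measurable_realfun spectral sesquilinear complex.
From mathcomp Require Import ring lra.

Set Implicit Arguments.
Unset Strict Implicit.
Unset Printing Implicit Defensive.

Import Order.TTheory GRing.Theory Num.Theory.
Local Open Scope ring_scope.
Local Open Scope classical_set_scope.

(** * Independence and expectation *)

Definition indep_pair d (T : measurableType d) (R : realType)
    (P : probability T R) d1 d2 (T1 : measurableType d1)
    (T2 : measurableType d2) (f : T -> T1) (g : T -> T2) : Prop :=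
  forall U V, measurable U -> measurable V ->
    (P (f @^-1` U `&` g @^-1` V) = P (f @^-1` U) * P (g @^-1` V))%E.

Section Independence.
Local Open Scope ereal_scope.
Context {d : measure_display} {T : measurableType d} {R : realType}.
Variable P : probability T R.

(** The two measures agree on measurable rectangles, and these determine the product measure. *)
Lemma indep_pair_law d1 d2 (T1 : measurableType d1) (T2 : measurableType d2)
    (f : {mfun T >-> T1}) (g : {mfun T >-> T2}) (fg : {mfun T >-> (T1 * T2)%type}) :
  indep_pair P f g -> (forall w, fg w = (f w, g w)) ->
  forall X, measurable X ->
    (distribution P f \x distribution P g) X = distribution P fg X.
Proof.
move=> fgP fgE X mX; apply: product_measure_unique => // U V mU mV.
rewrite /distribution /pushforward -fgP //; congr (P _).
by apply/seteqP; split => w /=; rewrite fgE.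
Qed.

(** By Fubini under the joint law, which is the product of the two marginal laws. Integrability of
    the product is part of the conclusion. *)
Lemma indep_pair_mul (f g : T -> R) :
  P.-integrable setT (EFin \o f) -> P.-integrable setT (EFin \o g) ->
  indep_pair P f g ->
  P.-integrable setT (EFin \o (f \* g)%R) /\
  (\int[P]_w (f w * g w))%R = (\int[P]_w f w * \int[P]_w g w)%R.
Proof.
move=> fint gint fgP.
have mf : measurable_fun setT f by apply/measurable_EFinP; exact: measurable_int fint.
have mg : measurable_fun setT g by apply/measurable_EFinP; exact: measurable_int gint.
have mfg : measurable_fun setT (fun w => (f w, g w)).
  exact: (measurable_fun_pair mf mg).
pose f' : {mfun T >-> R} := HB.pack f (isMeasurableFun.Build _ _ _ _ _ mf).
pose g' : {mfun T >-> R} := HB.pack g (isMeasurableFun.Build _ _ _ _ _ mg).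
pose fg' : {mfun T >-> (R * R)%type} := HB.pack (fun w => (f w, g w))
  (isMeasurableFun.Build _ _ _ _ _ mfg).
pose mu := distribution P f'; pose nu := distribution P g'.
have lawE := @indep_pair_law _ _ _ _ f' g' fg' fgP (fun=> erefl).
have mmul : measurable_fun [set: R * R] (fun z : R * R => z.1 * z.2)%R.
  exact: measurable_funM.
have mE : measurable_fun setT (EFin : R -> \bar R) by exact/measurable_EFinP.
have muint : mu.-integrable setT (EFin : R -> \bar R).
  exact/integrable_pushforward.
have nuint : nu.-integrable setT (EFin : R -> \bar R).
  exact/integrable_pushforward.
have [mufin nufin] := (integrable_fin_num measurableT muint,
  integrable_fin_num measurableT nuint).
(* Tonelli: the integral of |x y| is the product of two finite absolute moments. *)
have prodint : (mu \x nu).-integrable setT (fun z : R * R => (z.1 * z.2)%:E).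
  apply/integrable12ltyP; first exact/measurable_EFinP.
  have nuaint := integrable_abse nuint.
  rewrite [X in X < _](_ : _ =
      \int[mu]_x (`|x|%:E * \int[nu]_y `|y%:E|)); last first.
    apply: eq_integral => x _; rewrite -integralZl //.
    by apply: eq_integral => y _; rewrite /= normrM EFinM.
  have := integrable_fin_num measurableT nuaint => /fineK <-.
  have muaint := integrable_abse muint.
  rewrite integralZr //.
  have := integrable_fin_num measurableT muaint => /= /fineK.
  by move=> <-; rewrite -EFinM ltry.
have fgint : P.-integrable setT (EFin \o (f \* g)%R).
  apply/integrableP; split.
    by apply/measurable_EFinP; exact: measurable_funM.
  have mabs : measurable_fun setT (fun z : R * R => `|(z.1 * z.2)%:E|).
    by apply/measurableT_comp => //; exact/measurable_EFinP.
  rewrite -(@ge0_integral_distribution _ _ _ _ _ P fg' _ mabs) //.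
  rewrite (eq_measure_integral (mu \x nu)); last first.
    by move=> A mA _; exact/esym/lawE.
  by move/integrableP : prodint => [].
split => //.
rewrite /Rintegral -fineM.
- congr fine.
  have -> : \int[P]_w (f w * g w)%:E = \int[distribution P fg']_z (z.1 * z.2)%:E.
    by rewrite integral_distribution //; exact/measurable_EFinP.
  rewrite (eq_measure_integral (mu \x nu)); last first.
    by move=> A mA _; exact/esym/lawE.
  rewrite -(@integral12_prod_meas1 _ _ _ _ _ mu nu) // /fubini_F.
  transitivity (\int[mu]_x (x%:E * \int[nu]_y y%:E)).
    apply: eq_integral => x _; rewrite -integralZl //.
  rewrite -(fineK nufin) integralZr // fineK //.
  by rewrite /mu /nu !integral_distribution.
- exact: integrable_fin_num.
- exact: integrable_fin_num.
Qed.

End Independence.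

(** As functions of [E], both sides are finite measures: [P] restricted to [B], and [P] scaled by
    [P B]. They agree on the pi-system [G], hence on the sigma-algebra it generates. *)
Lemma indep_sigma_generated d (T : measurableType d) (R : realType)
    (P : probability T R) (G : set (set T)) (B : set T) :
  G `<=` measurable -> setI_closed G -> G setT -> measurable B ->
  (forall E, G E -> (P (E `&` B) = P E * P B)%E) ->
  forall E, <<s G >> E -> (P (E `&` B) = P E * P B)%E.
Proof.
move=> Gm GI GT mB GB E sE.
have PB0 : 0 <= fine (P B) by rewrite fine_ge0.
pose m1 : {measure set T -> \bar R} := mrestr P mB.
pose m2 : {measure set T -> \bar R} := mscale (NngNum PB0) P.
have PBE : (fine (P B))%:E = P B by rewrite fineK // fin_num_measure.
have m2E F : m2 F = (P F * P B)%E by rewrite -PBE muleC.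
rewrite -m2E -[LHS]/(m1 E).
apply: (g_sigma_algebra_measure_unique G _ (fun=> setT)) => //.
- by rewrite bigcup_const //; exists 0%N.
- by move=> F GF; rewrite m2E -GB.
- move=> _; rewrite /m1 /= /mrestr setTI.
  by rewrite (le_lt_trans (probability_le1 _ mB)) // ltry.
Qed.

(** * Independence of a sample from its predecessors *)

Section History.
Context {d d' : measure_display} {T : measurableType d}
  {T' : measurableType d'} {R : realType}.
Variables (P : probability T R) (S : nat -> T -> T').

(** Cylinder sets over the samples of index 0 to k-1. They form a pi-system that generates the
    sigma-algebra of the past, with [S k] itself excluded. *)
Definition history (k : nat) : set (set T) :=
  [set E | exists F : nat -> set T', (forall i, measurable (F i)) /\
     E = \bigcap_(i in [set` iota 0 k]) (S i @^-1` F i)].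

Hypothesis mS : forall k, measurable_fun setT (S k).
Hypothesis indepS : forall (I : seq nat) (E : nat -> set T'), uniq I ->
  (forall i, measurable (E i)) ->
  P (\bigcap_(i in [set` I]) (S i @^-1` E i)) =
  (\prod_(i <- I) P (S i @^-1` E i))%E.

Let mpre k (F : set T') : measurable F -> measurable (S k @^-1` F).
Proof. by move=> mF; rewrite -[X in measurable X]setTI; exact: mS. Qed.

Lemma history_sub_measurable k : history k `<=` measurable.
Proof.
move=> _ [F [mF ->]]; apply: fin_bigcap_measurable; first exact: finite_seq.
by move=> i _; exact: mpre.
Qed.

Lemma history_setI_closed k : setI_closed (history k).
Proof.
move=> _ _ [E [mE ->]] [F [mF ->]]; exists (fun i => E i `&` F i); split.
  by move=> i; exact: measurableI.
apply/seteqP; split => w /=.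
  by move=> [Ew Fw] i ik; split; [exact: Ew | exact: Fw].
by move=> EFw; split=> i ik; case: (EFw i ik).
Qed.

Lemma history_setT k : history k setT.
Proof. by exists (fun=> setT); split=> //; apply/seteqP; split. Qed.

Lemma history_preimage k l F : (l < k)%N -> measurable F ->
  history k (S l @^-1` F).
Proof.
move=> lk mF; exists (fun i => if i == l then F else setT); split.
  by move=> i; case: ifP.
apply/seteqP; split => w /=.
  by move=> Fw i ik /=; case: eqP => // ->.
by move=> /(_ l) /=; rewrite mem_iota lk eqxx; exact.
Qed.

Lemma history_indep_next k E F : <<s history k >> E -> measurable F ->
  (P (E `&` S k @^-1` F) = P E * P (S k @^-1` F))%E.
Proof.
move=> sE mF; apply: (indep_sigma_generated _ _ _ _ _ sE).
- exact: history_sub_measurable.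
- exact: history_setI_closed.
- exact: history_setT.
- exact: mpre.
move=> _ [G [mG ->]].
(* [H] appends the constraint [F] at index [k], so that the intersection becomes one cylinder over
   [iota 0 k.+1], to which joint independence applies. *)
pose H i := if i == k then F else G i.
have mH i : measurable (H i) by rewrite /H; case: ifP.
have HG i : i \in iota 0 k -> H i = G i.
  by rewrite mem_iota /H /= => ik; rewrite ltn_eqF.
have := indepS (iota_uniq 0 k.+1) mH.
have := indepS (iota_uniq 0 k) mG.
have prodE : (\prod_(i <- iota 0 k) P (S i @^-1` H i) =
              \prod_(i <- iota 0 k) P (S i @^-1` G i))%E.
  by apply: eq_big_seq => i /HG ->.
have Hk : H k = F by rewrite /H eqxx.
rewrite -[in iota 0 k.+1]addn1 iotaD add0n big_cat big_seq1 /= prodE Hk.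
move=> -> <-; congr (P _); apply/seteqP; split => w /=.
  move=> [Gw Fw] i /=; rewrite mem_cat => /orP[ik|].
    by rewrite HG //; exact: Gw.
  by rewrite inE => /eqP ->; rewrite /H eqxx.
move=> Hw; split.
  by move=> i /= ik; rewrite -(HG i) //; apply: Hw => /=; rewrite mem_cat ik.
have := Hw k; rewrite /= mem_cat inE eqxx orbT => /(_ isT).
by rewrite /H eqxx.
Qed.

Lemma history_measurable k l : (l < k)%N ->
  measurable_fun (setT : set (g_sigma_algebraType (history k))) (S l).
Proof.
move=> lk _ F mF; rewrite setTI; apply: sub_sigma_algebra.
exact: history_preimage.
Qed.

Lemma history_indep_pair k d1 (T1 : measurableType d1) d2
    (T2 : measurableType d2) (f : T' -> T2) (g : T -> T1) :
  measurable_fun setT f ->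
  measurable_fun (setT : set (g_sigma_algebraType (history k))) g ->
  indep_pair P (f \o S k) g.
Proof.
move=> mf mg U V mU mV; rewrite setIC muleC.
apply: (@history_indep_next k (g @^-1` V) (f @^-1` U)).
  by have := mg measurableT V mV; rewrite setTI.
by have := mf measurableT U mU; rewrite setTI.
Qed.

End History.

(** * Entrywise expectation of random matrices *)

Section MatrixExpectation.
Context {d : measure_display} {T : measurableType d} {R : realType}.
Variable P : probability T R.

Definition mx_integrable p q (X : T -> 'M[R]_(p, q)) : Prop :=
  forall i j, P.-integrable setT (EFin \o (fun w => X w i j)).

Definition mx_mean p q (X : T -> 'M[R]_(p, q)) : 'M[R]_(p, q) :=
  \matrix_(i, j) \int[P]_w X w i j.

Lemma integrable_fsum I (r : seq I) (f : I -> T -> R) :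
  (forall i, P.-integrable setT (EFin \o f i)) ->
  P.-integrable setT (EFin \o (fun w => \sum_(i <- r) f i w)) /\
  \int[P]_w (\sum_(i <- r) f i w) = \sum_(i <- r) \int[P]_w f i w.
Proof.
move=> fint; elim: r => [|i r [IHi IHe]].
  rewrite big_nil; split.
    by apply: eq_integrable (integrable0 _ _) => // w _ /=; rewrite big_nil.
  under eq_Rintegral do rewrite big_nil.
  by rewrite Rintegral_cst // mul0r.
rewrite big_cons -IHe -RintegralD //; split.
  apply: eq_integrable (integrableD measurableT (fint i) IHi) => // w _ /=.
  by rewrite big_cons EFinD.
by apply: eq_Rintegral => w _; rewrite big_cons.
Qed.

Lemma integrable_scalel (c : R) (f : T -> R) :
  P.-integrable setT (EFin \o f) ->
  P.-integrable setT (EFin \o (fun w => c * f w)).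
Proof.
move=> fint.
by apply: eq_integrable (integrableZl measurableT c fint) => // w _ /=.
Qed.

Lemma mx_mean_cst p q (C : 'M[R]_(p, q)) :
  mx_integrable (fun=> C) /\ mx_mean (fun=> C) = C.
Proof.
split; first by move=> i j; exact: finite_measure_integrable_cst.
apply/matrixP => i j; rewrite mxE Rintegral_cst //.
by rewrite [X in fine X](_ : _ = 1%E) ?mulr1 //; exact: probability_setT.
Qed.

Lemma mx_meanD p q (X Y : T -> 'M[R]_(p, q)) :
  mx_integrable X -> mx_integrable Y ->
  mx_integrable (fun w => X w + Y w) /\
  mx_mean (fun w => X w + Y w) = mx_mean X + mx_mean Y.
Proof.
move=> Xint Yint; split => [i j|].
  apply: eq_integrable (integrableD measurableT (Xint i j) (Yint i j)) => //.
  by move=> w _ /=; rewrite mxE EFinD.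
apply/matrixP => i j; rewrite !mxE -RintegralD //.
by apply: eq_Rintegral => w _; rewrite mxE.
Qed.

Lemma mx_meanMl p q r (C : 'M[R]_(r, p)) (X : T -> 'M[R]_(p, q)) :
  mx_integrable X ->
  mx_integrable (fun w => C *m X w) /\
  mx_mean (fun w => C *m X w) = C *m mx_mean X.
Proof.
move=> Xint.
have CXint i j k : P.-integrable setT (EFin \o (fun w => C i k * X w k j)).
  exact: integrable_scalel.
split => [i j|].
  have [+ _] := integrable_fsum (index_enum _) (CXint i j).
  by apply: eq_integrable => // w _ /=; rewrite mxE.
apply/matrixP => i j; rewrite !mxE.
transitivity (\int[P]_w (\sum_k C i k * X w k j)).
  by apply: eq_Rintegral => w _; rewrite mxE.
rewrite (integrable_fsum (index_enum _) (CXint i j)).2.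
by apply: eq_bigr => k _; rewrite mxE RintegralZl.
Qed.

Lemma mx_meanZ p q (c : R) (X : T -> 'M[R]_(p, q)) :
  mx_integrable X ->
  mx_integrable (fun w => c *: X w) /\
  mx_mean (fun w => c *: X w) = c *: mx_mean X.
Proof.
move=> Xint; have := mx_meanMl c%:M Xint.
by rewrite mul_scalar_mx; under eq_fun do rewrite mul_scalar_mx.
Qed.

Lemma mx_meanB p q (X Y : T -> 'M[R]_(p, q)) :
  mx_integrable X -> mx_integrable Y ->
  mx_integrable (fun w => X w - Y w) /\
  mx_mean (fun w => X w - Y w) = mx_mean X - mx_mean Y.
Proof.
move=> Xint Yint; have [Nint NE] := mx_meanZ (-1) Yint.
have [] := mx_meanD Xint Nint; rewrite NE scaleN1r.
by under eq_fun do rewrite scaleN1r.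
Qed.

Lemma mx_mean_tr p q (X : T -> 'M[R]_(p, q)) :
  mx_mean (fun w => (X w)^T) = (mx_mean X)^T.
Proof.
by apply/matrixP => i j; rewrite !mxE; apply: eq_Rintegral => w _; rewrite mxE.
Qed.

Lemma mx_meanMr p q r (C : 'M[R]_(q, r)) (X : T -> 'M[R]_(p, q)) :
  mx_integrable X ->
  mx_integrable (fun w => X w *m C) /\
  mx_mean (fun w => X w *m C) = mx_mean X *m C.
Proof.
move=> Xint.
have Xtint : mx_integrable (fun w => (X w)^T).
  move=> i j; apply: eq_integrable (Xint j i) => // w _ /=.
  by rewrite mxE.
have [Mint ME] := mx_meanMl C^T Xtint; split => [i j|].
  by apply: eq_integrable (Mint j i) => // w _ /=; rewrite -trmx_mul mxE.
apply: trmx_inj; rewrite trmx_mul -mx_mean_tr -[X in _ *m X]mx_mean_tr -ME.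
by congr mx_mean; apply/funext => w; rewrite trmx_mul.
Qed.

(** Each entry of the product is a sum of products of one entry of [X] and one of [Y], so the
    expectation factors term by term. *)
Lemma mx_mean_indepM p q r (X : T -> 'M[R]_(p, q)) (Y : T -> 'M[R]_(q, r)) :
  mx_integrable X -> mx_integrable Y ->
  (forall i k j, indep_pair P (fun w => X w i k) (fun w => Y w k j)) ->
  mx_integrable (fun w => X w *m Y w) /\
  mx_mean (fun w => X w *m Y w) = mx_mean X *m mx_mean Y.
Proof.
move=> Xint Yint XY.
have XYint i j k := indep_pair_mul (Xint i k) (Yint k j) (XY i k j).
have XYsum i j := integrable_fsum (index_enum _) (fun k => (XYint i j k).1).
split => [i j|].
  by apply: eq_integrable (XYsum i j).1 => // w _ /=; rewrite mxE.
apply/matrixP => i j; rewrite !mxE.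
transitivity (\int[P]_w (\sum_k X w i k * Y w k j)).
  by apply: eq_Rintegral => w _; rewrite mxE.
rewrite (XYsum i j).2; apply: eq_bigr => k _.
by rewrite (XYint i j k).2 !mxE.
Qed.

Lemma mx_mean_qform n (X : T -> 'M[R]_n) (v : 'cV[R]_n) :
  mx_integrable X ->
  P.-integrable setT (EFin \o (fun w => (v^T *m X w *m v) 0 0)) /\
  \int[P]_w (v^T *m X w *m v) 0 0 = (v^T *m mx_mean X *m v) 0 0.
Proof.
move=> Xint; have [Lint LE] := mx_meanMl v^T Xint.
have [Rint RE] := mx_meanMr v Lint; split; first exact: Rint.
by rewrite -LE -RE mxE.
Qed.

End MatrixExpectation.

Lemma mx_mean_law d d' (T : measurableType d) (T' : measurableType d')
    (R : realType) (P : probability T R) (D : probability T' R) (S : T -> T')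
    p q (X : T' -> 'M[R]_(p, q)) :
  measurable_fun setT S ->
  (forall E, measurable E -> P (S @^-1` E) = D E) ->
  mx_integrable D X ->
  mx_integrable P (X \o S) /\ mx_mean P (X \o S) = mx_mean D X.
Proof.
move=> mS SD Xint.
pose S' : {mfun T >-> T'} := HB.pack S (isMeasurableFun.Build _ _ _ _ _ mS).
have lawE A : measurable A -> A `<=` setT -> distribution P S' A = D A.
  by move=> mA _; exact: SD.
have mX i j : measurable_fun setT (fun s => (X s i j)%:E).
  exact: measurable_int (Xint i j).
have XSint : mx_integrable P (X \o S).
  move=> i j; apply/integrableP; split.
    exact: (measurableT_comp (mX i j) mS).
  have mabs : measurable_fun setT (fun s => `|(X s i j)%:E|%E).
    exact: measurableT_comp (mX i j).
  have := @ge0_integral_distribution _ _ _ _ _ P S' _ mabs (fun=> abse_ge0 _).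
  move=> /= <-; rewrite (eq_measure_integral D) //.
  by have /integrableP[] := Xint i j.
split=> //; apply/matrixP => i j; rewrite !mxE /Rintegral; congr fine.
have := @integral_distribution _ _ _ _ _ P S' _ (mX i j) (XSint i j).
by move=> /= <-; exact: eq_measure_integral.
Qed.

(** * The matrix Z *)

(** With M symmetric, the Penrose equations give X M M = M = M M X, so that M X = X M M X = X M.
    Then X^T = X^T M X^T turns into X M X = X. *)
Lemma pinv_sym (R : realType) p (M : 'M[R]_p) : M^T = M ->
  (Defs.pinv M)^T = Defs.pinv M /\ Defs.pinv M *m M *m Defs.pinv M = Defs.pinv M.
Proof.
(* The default value 0 of [xget] satisfies both equations trivially. *)
move=> Msym; rewrite /Defs.pinv; case: xgetP => [X _ [MXM XMX MXs XMs]|_]; last first.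
  by rewrite trmx0 !mul0mx.
split=> //.
have MXt : M *m X^T = X *m M by rewrite -XMs trmx_mul Msym.
have XtM : X^T *m M = M *m X by rewrite -MXs trmx_mul Msym.
have XMM : X *m (M *m M) = M.
  apply: trmx_inj; rewrite !trmx_mul Msym -mulmxA MXt mulmxA; exact: MXM.
have MMX : (M *m M) *m X = M.
  apply: trmx_inj; rewrite !trmx_mul Msym mulmxA XtM; exact: MXM.
have comm : M *m X = X *m M by rewrite -{1}XMM -mulmxA MMX.
have XtMXt : X^T *m M *m X^T = X^T.
  by rewrite -[RHS](congr1 trmx XMX) !trmx_mul Msym mulmxA.
by rewrite -XtMXt XtM comm -mulmxA MXt mulmxA -[RHS]XMX -!mulmxA comm.
Qed.

(** * Quadratic forms of B-orthogonal projections *)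

Section SPD.
Context {R : realType} {n : nat}.
Implicit Types (B Z : 'M[R]_n) (v : 'cV[R]_n).

Lemma spd_ge0 B v : spd B -> 0 <= (v^T *m B *m v) 0 0.
Proof.
move=> [_ Bpos]; have [->|/Bpos/ltW //] := eqVneq v 0.
by rewrite mulmx0 mxE.
Qed.

Lemma spd_unitmx B : spd B -> B \in unitmx.
Proof.
move=> [Bsym Bpos]; rewrite -row_free_unit; apply: inj_row_free => v vB.
apply/eqP; apply: contraT => v0.
have := Bpos v^T; rewrite trmxK vB mul0mx mxE ltxx; apply.
by rewrite -trmx0 (inj_eq trmx_inj).
Qed.

Lemma spd_invmx_tr B : spd B -> (invmx B)^T = invmx B.
Proof. by move=> [Bsym _]; rewrite trmx_inv Bsym. Qed.

Variables (B Z : 'M[R]_n).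
Hypotheses (Bspd : spd B) (Zsym : Z^T = Z) (ZBZ : Z *m invmx B *m Z = Z).

(** The hypotheses make [invmx B *m Z] a projection that is self-adjoint for the B-inner product;
    the form of [Z] at [v] is the squared B-norm of the projected vector. *)
Let qformE v : v^T *m Z *m v = (invmx B *m Z *m v)^T *m B *m (invmx B *m Z *m v).
Proof.
rewrite !trmx_mul Zsym spd_invmx_tr // -!mulmxA mulKVmx ?spd_unitmx //.
by rewrite !mulmxA -[_ *m Z *m invmx B *m Z]mulmxA -mulmxA -[in LHS]ZBZ !mulmxA.
Qed.

Lemma oblique_qform_ge0 v : 0 <= (v^T *m Z *m v) 0 0.
Proof. by rewrite qformE spd_ge0. Qed.

(* B - Z is nonnegative since v - B^-1 Z v has squared B-norm v^T B v - v^T Z v. *)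
Lemma oblique_qform_le v : (v^T *m Z *m v) 0 0 <= (v^T *m B *m v) 0 0.
Proof.
have := spd_ge0 (v - invmx B *m Z *m v) Bspd.
rewrite [(_ - _)^T]linearB /= mulmxBl mulmxBl !mulmxBr -qformE.
have -> : v^T *m B *m (invmx B *m Z *m v) = v^T *m Z *m v.
  by rewrite -!mulmxA mulKVmx ?spd_unitmx.
have -> : (invmx B *m Z *m v)^T *m B *m v = v^T *m Z *m v.
  rewrite !trmx_mul Zsym spd_invmx_tr // -!mulmxA mulKmx ?spd_unitmx //.
by rewrite subrr subr0 !mxE subr_ge0.
Qed.

End SPD.

(** In Z B^-1 Z the middle factor S^T A B^-1 A^T S is the matrix M whose pseudoinverse X enters Z,
    so the product collapses by X M X = X. *)
Lemma Zmat_oblique (R : realType) m n (A : 'M[R]_(m, n)) (B : 'M[R]_n)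
    (s : Sk R m) : spd B ->
  (Zmat A B s)^T = Zmat A B s /\
  Zmat A B s *m invmx B *m Zmat A B s = Zmat A B s.
Proof.
move=> Bspd; rewrite /Zmat /Hmat; case: s => q S.
set M := S^T *m A *m _ *m _ *m S.
have [Xsym XMX] : (Defs.pinv M)^T = Defs.pinv M /\ Defs.pinv M *m M *m Defs.pinv M = Defs.pinv M.
  apply: pinv_sym.
  by rewrite /M !trmx_mul !trmxK spd_invmx_tr // !mulmxA.
split; first by rewrite !trmx_mul !trmxK Xsym !mulmxA.
by rewrite -[in RHS]XMX /M !mulmxA.
Qed.

(** * Spectral bounds and the energy of the recursion *)

Section SpectralMeasure.
Local Open Scope sesquilinear_scope.
Local Open Scope complex_scope.
Context {R : realType} {n : nat}.
Variable W : 'M[R]_n.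
Hypothesis Wsym : W^T = W.

(** The [wt i] are masses of the spectral measure of [W] at [v]: squared moduli of the coordinates
    of [v] in a unitary eigenbasis. Its moments reduce inequalities between quadratic forms in [W]
    to scalar ones at each eigenvalue. *)
Lemma sym_spectral_measure (v : 'cV[R]_n) :
  exists lam wt : 'I_n -> R,
    [/\ forall i, eigenvalue W (lam i), forall i, 0 <= wt i &
        forall k, (v^T *m iter k (mulmx W) v) 0 0 = \sum_i lam i ^+ k * wt i].
Proof.
(* The spectral theorem is applied to the complexification of [W], which is Hermitian and so has
   real eigenvalues. *)
pose toC := real_complex R : {rmorphism R -> R[i]}.
pose WC := map_mx toC W; pose vC := map_mx toC v.
have conjtoC p q (M : 'M[R]_(p, q)) : (map_mx toC M) ^ Num.conj = map_mx toC M.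
  apply/matrixP => i j; rewrite !mxE; apply/CrealP/complex_realP.
  by exists (M i j).
have WCherm : WC \is hermsymmx.
  by apply/is_hermitianmxP; rewrite expr0 scale1r map_trmx Wsym conjtoC.
have /orthomx_spectralP := hermitian_normalmx WCherm.
have spR := hermitian_spectral_diag_real WCherm.
set Q := spectralmx WC; set sp := spectral_diag WC => WCE.
have Qunit : Q \in unitmx := spectral_unit WC.
have Qinv : invmx Q = Q^t* by apply/invmx_unitary/spectral_unitarymx.
have lamE i : sp 0 i = toC (complex.Re (sp 0 i)).
  by apply/esym/RRe_real; apply: (mxOverP spR).
pose z := Q *m vC.
have nrmE i : `|z i 0| ^+ 2 = toC (complex.Re (`|z i 0| ^+ 2)).
  by apply/esym/RRe_real; rewrite ger0_real // exprn_ge0.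
exists (fun i => complex.Re (sp 0 i)), (fun i => complex.Re (`|z i 0| ^+ 2)); split.
(* Eigenvalues descend to [W] as roots of the same characteristic polynomial; row i of [Q] is a left
   eigenvector, nonzero because [Q] is invertible. *)
- move=> i; rewrite eigenvalue_root_char -(fmorph_root toC) map_char_poly -/WC.
  rewrite -lamE -eigenvalue_root_char; apply/eigenvalueP; exists (row i Q).
    rewrite -row_mul {1}WCE !mulmxA mulmxV // mul1mx row_mul.
    by rewrite row_diag_mx -scalemxAl -rowE.
  apply/eqP => Qi0; have := congr1 (mulmx^~ (invmx Q)) Qi0.
  rewrite mul0mx -row_mul mulmxV // => /rowP /(_ i).
  by rewrite !mxE eqxx => /eqP; rewrite oner_eq0.
- by move=> i; rewrite -ler0c -/(toC _) -nrmE exprn_ge0.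
move=> k; apply: (fmorph_inj toC); rewrite rmorph_sum.
have iterE : map_mx toC (iter k (mulmx W) v) =
    invmx Q *m (\col_i (sp 0 i ^+ k * z i 0)).
  elim: k => [|k IHk] /=.
    rewrite -[LHS](mulKmx Qunit); congr (_ *m _).
    by apply/colP => i; rewrite [RHS]mxE expr0 mul1r.
  rewrite map_mxM IHk -/WC {1}WCE mulmxA mulmxK // -mulmxA.
  congr (_ *m _).
  by apply/colP => i; rewrite mul_diag_mx [LHS]mxE !mxE exprS mulrA.
transitivity ((map_mx toC (v^T *m iter k (mulmx W) v)) 0 0); first by rewrite [RHS]mxE.
rewrite map_mxM iterE Qinv mulmxA.
have -> : map_mx toC v^T *m Q^t* = z^t*.
  by rewrite /z trmx_mul map_mxM map_trmx conjtoC.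
rewrite mxE; apply: eq_bigr => i _.
have -> : z^t* 0 i = (z i 0)^* by rewrite !mxE.
by rewrite [X in _ * X]mxE [RHS]rmorphM rmorphXn -lamE -nrmE normCKC mulrCA.
Qed.

End SpectralMeasure.

(** * The energy of the second-order recursion *)

Section HeavyBallEnergy.
Context {R : realType} {n : nat}.

Definition dotv (x y : 'cV[R]_n) : R := (x^T *m y) 0 0.

Lemma dotvC x y : dotv x y = dotv y x.
Proof. by rewrite /dotv !mxE; apply: eq_bigr => i _; rewrite !mxE mulrC. Qed.

Lemma dotvDl x y z : dotv (x + y) z = dotv x z + dotv y z.
Proof. by rewrite /dotv linearD mulmxDl mxE. Qed.

Lemma dotvZl a x z : dotv (a *: x) z = a * dotv x z.
Proof. by rewrite /dotv linearZ -scalemxAl mxE. Qed.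

Lemma dotvNl x z : dotv (- x) z = - dotv x z.
Proof. by rewrite /dotv linearN mulNmx mxE. Qed.

Lemma dotvDr x y z : dotv z (x + y) = dotv z x + dotv z y.
Proof. by rewrite !(dotvC z) dotvDl. Qed.

Lemma dotvZr a x z : dotv z (a *: x) = a * dotv z x.
Proof. by rewrite !(dotvC z) dotvZl. Qed.

Lemma dotvNr x z : dotv z (- x) = - dotv z x.
Proof. by rewrite !(dotvC z) dotvNl. Qed.

Lemma dotv_ge0 x : 0 <= dotv x x.
Proof. by rewrite /dotv mxE sumr_ge0 // => i _; rewrite mxE -expr2 sqr_ge0. Qed.

Definition dotvE := (dotvDl, dotvDr, dotvZl, dotvZr, dotvNl, dotvNr).

Variable W : 'M[R]_n.
Hypothesis Wsym : W^T = W.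

Lemma dotv_sym x y : dotv (W *m x) y = dotv x (W *m y).
Proof. by rewrite /dotv trmx_mul Wsym mulmxA. Qed.

Variables (lo hi om beta : R).
Hypothesis lo_gt0 : 0 < lo.
Hypothesis W_eig : forall a, eigenvalue W a -> a != 0 -> lo <= a <= hi.
Hypothesis om_gt0 : 0 < om.
Hypothesis om_hi : om * hi <= 1.
Hypothesis om_lo : om * lo <= 1.
Hypothesis beta_gt : (1 - Num.sqrt (om * lo)) ^+ 2 < beta.
Hypothesis beta_lt1 : beta < 1.

(** The bounded quantity is minus a quarter of the discriminant of t^2 - (1 + beta - om a) t + beta,
    the characteristic polynomial of the recursion along an eigenvector for a. *)
Lemma discriminant_gap : exists2 c : R, 0 < c &
  forall a, eigenvalue W a -> a != 0 ->
    c <= beta - (1 + beta - om * a) ^+ 2 / 4.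
Proof.
have beta_gt0 : 0 < beta by apply: le_lt_trans beta_gt; exact: sqr_ge0.
pose s := Num.sqrt (om * lo).
have s2 : s ^+ 2 = om * lo by rewrite sqr_sqrtr // mulr_ge0 // ltW.
pose r := Num.sqrt beta.
have r2 : r ^+ 2 = beta by rewrite sqr_sqrtr // ltW.
have r_gt0 : 0 < r by rewrite sqrtr_gt0.
have r_lt1 : r < 1.
  by rewrite -sqrtr1 ltr_sqrt.
have s_ge0 : 0 <= s by exact: sqrtr_ge0.
have s_le1 : s <= 1 by rewrite -sqrtr1 ler_sqrt.
have rs : 1 - s < r.
  by rewrite -(@ltr_pXn2r _ 2) ?nnegrE ?subr_ge0 ?(ltW r_gt0) // r2.
(* [g] and [h] bound the two factors of the gap from below, using om lo <= om a for the first and om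
   a <= 1 for the second. *)
pose g := om * lo - (1 - r) ^+ 2.
have g_gt0 : 0 < g.
  by rewrite /g -s2 subr_gt0 ltr_pXn2r ?nnegrE ?subr_ge0 ?(ltW r_lt1) //; lra.
pose h := (1 + r) ^+ 2 - 1.
have h_gt0 : 0 < h by rewrite /h; nra.
exists (g * h / 4); first by rewrite divr_gt0 ?mulr_gt0.
move=> a a_eig a0; have /andP[lo_a a_hi] := W_eig a_eig a0.
have oma : om * lo <= om * a by rewrite ler_pM2l.
have oma1 : om * a <= 1 by apply: le_trans om_hi; rewrite ler_pM2l.
have -> : beta - (1 + beta - om * a) ^+ 2 / 4 =
    (om * a - (1 - r) ^+ 2) * ((1 + r) ^+ 2 - om * a) / 4.
  by rewrite -r2; field.
rewrite ler_pM2r ?invr_gt0 //; apply: ler_pM; rewrite ?(ltW g_gt0) ?(ltW h_gt0) //.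
  by rewrite /g lerB.
by rewrite /h lerB.
Qed.

(** At eigenvalue 0 the gap is negative. Writing y = W u and using the spectral measure at u puts a
    factor lam^2 on every term, which removes that eigenvalue. *)
Lemma range_coercive : exists2 c : R, 0 < c & forall u y z,
  y = W *m u -> z = (1 + beta) *: y - om *: (W *m y) ->
  c * dotv y y <= beta * dotv y y - dotv z z / 4.
Proof.
have [c c_gt0 cP] := discriminant_gap; exists c => // u y z yE zE.
have [lam [wt [lam_eig wt_ge0 momE]]] := sym_spectral_measure Wsym u.
have yyE : dotv y y = \sum_i lam i ^+ 2 * wt i.
  by rewrite -momE yE dotv_sym /dotv.
have yWyE : dotv y (W *m y) = \sum_i lam i ^+ 3 * wt i.
  by rewrite -momE yE dotv_sym /dotv.
have WyWyE : dotv (W *m y) (W *m y) = \sum_i lam i ^+ 4 * wt i.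
  by rewrite -momE yE !dotv_sym /dotv.
have -> : beta * dotv y y - dotv z z / 4 =
    \sum_i (beta - (1 + beta - om * lam i) ^+ 2 / 4) * lam i ^+ 2 * wt i.
  rewrite zE !dotvE (dotvC (W *m y) y) yyE yWyE WyWyE.
  under [RHS]eq_bigr => i _.
    rewrite (_ : _ * wt i = (beta - (1 + beta) ^+ 2 / 4) * (lam i ^+ 2 * wt i)
      + (1 + beta) * om / 2 * (lam i ^+ 3 * wt i)
      - om ^+ 2 / 4 * (lam i ^+ 4 * wt i)); last by field.
    over.
  by rewrite sumrB big_split /= -!mulr_sumr; field.
rewrite yyE mulr_sumr; apply: ler_sum => i _; rewrite mulrA.
apply: ler_wpM2r => //.
have [->|lam0] := eqVneq (lam i) 0; first by rewrite expr0n /= !mulr0.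
by apply: ler_wpM2r; [exact: sqr_ge0 | exact: cP].
Qed.

Lemma heavy_ball_decay (y : nat -> 'cV[R]_n) :
  (forall k, exists u, y k = W *m u) ->
  (forall k, y k.+2 = (1 + beta) *: y k.+1 - om *: (W *m y k.+1) - beta *: y k) ->
  exists C : R, 0 < C /\ forall k, dotv (y k) (y k) <= beta ^+ k * C.
Proof.
move=> yu yrec; have [c c_gt0 cP] := range_coercive.
have beta_ge0 : 0 <= beta by apply/ltW; apply: le_lt_trans beta_gt; exact: sqr_ge0.
pose M (v : 'cV[R]_n) := (1 + beta) *: v - om *: (W *m v).
pose E k := dotv (y k.+1) (y k.+1) - dotv (y k.+1) (M (y k)) + beta * dotv (y k) (y k).
have Estep k : E k.+1 = beta * E k.
  (* Since y_(k+2) - M y_(k+1) = - beta y_k, every term of E_(k+1) carries a factor beta, and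
     symmetry of W moves M from y_(k+1) to y_k. *)
  rewrite /E /M yrec !dotvE.
  rewrite -(dotv_sym (y k.+1) (y k)) !(dotvC _ (W *m y k.+1)).
  rewrite !(dotvC (y k) (y k.+1)); ring.
have EE k : E k = beta ^+ k * E 0%N.
  by elim: k => [|k IHk]; rewrite ?expr0 ?mul1r // Estep IHk exprS mulrA.
have Elow k : c * dotv (y k) (y k) <= E k.
  have [u yuE] := yu k.
  have /le_trans := cP _ _ _ yuE (erefl (M (y k))); apply.
  rewrite /E; move: (M (y k)) => v.
  (* Completing the square: E_k exceeds the coercive form at y_k by exactly |y_(k+1) - v/2|^2. *)
  have := dotv_ge0 (y k.+1 - 2^-1 *: v).
  rewrite !dotvE (dotvC v (y k.+1)) => h.
  rewrite -subr_ge0; apply: le_trans h _; rewrite le_eqVlt; apply/orP; left.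
  by apply/eqP; field.
have E0 : 0 <= E 0%N by apply: le_trans (Elow 0%N); rewrite mulr_ge0 ?dotv_ge0 // ltW.
(* The summand 1 keeps the constant positive when the initial energy is 0. *)
exists (E 0%N / c + 1); split; first by rewrite ltr_pwDr // divr_ge0 // ltW.
move=> k; apply: (@le_trans _ _ (E k / c)).
  by rewrite ler_pdivlMr // mulrC.
by rewrite EE -mulrA ler_wpM2l ?exprn_ge0 // lerDl.
Qed.

End HeavyBallEnergy.

(** * Range conditions and the mean of Z *)

(** The columns of [cokermx M] lie in the null space of M, hence in that of N; so N kills the
    cokernel, which is inclusion of row spaces. *)
Lemma submx_of_null (F : fieldType) m1 m2 n (N : 'M[F]_(m1, n))
    (M : 'M[F]_(m2, n)) :
  (forall v : 'cV[F]_n, M *m v = 0 -> N *m v = 0) ->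
  exists K : 'M[F]_(m1, m2), N = K *m M.
Proof.
move=> MN; apply/submxP; rewrite submxE; apply/eqP/trmx_inj/row_matrixP => j.
rewrite trmx0 row0 -tr_col -trmx0; congr _^T.
by rewrite colE -mulmxA -colE MN // colE mulmxA mulmx_coker mul0mx.
Qed.

(** * The B-orthogonal projection onto the solution set *)

Section BProjection.
Context {R : realType} {m n : nat}.
Variables (A : 'M[R]_(m, n)) (b : 'cV[R]_m) (B : 'M[R]_n) (x0 xstar : 'cV[R]_n).

Lemma bnorm_sqr (v : 'cV[R]_n) : spd B -> bnorm B v ^+ 2 = (v^T *m B *m v) 0 0.
Proof. by move=> Bspd; rewrite /bnorm sqr_sqrtr // spd_ge0. Qed.

(** First-order optimality makes (xstar - x0)^T B vanish on Null(A), so this row vector factors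
    through A; transposing and applying B^-1 gives the claim. *)
Lemma projection_range : spd B -> A *m xstar = b ->
  (forall x, A *m x = b -> bnorm B (xstar - x0) <= bnorm B (x - x0)) ->
  exists c : 'cV[R]_m, x0 - xstar = invmx B *m A^T *m c.
Proof.
move=> Bspd Axstar xmin; have [Bsym _] := Bspd.
have [v vE] : exists v, v = xstar - x0 by exists (xstar - x0).
have orth (h : 'cV[R]_n) : A *m h = 0 -> (v^T *m B) *m h = 0.
  move=> Ah; set g := v^T *m B *m h.
  (* The points xstar + t h are feasible, so the increment of the squared distance is a nonnegative
     quadratic in t. *)
  have gt (t : R) : 0 <= 2 * t * g 0 0 + t ^+ 2 * (h^T *m B *m h) 0 0.
    have := xmin (xstar + t *: h); rewrite mulmxDr Axstar -scalemxAr Ah.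
    rewrite scaler0 addr0 => /(_ erefl).
    rewrite -(@ler_pXn2r _ 2) ?nnegrE ?sqrtr_ge0 // !bnorm_sqr //.
    rewrite addrAC -vE.
    rewrite [(v + _)^T]linearD /= linearZ /= !mulmxDl !mulmxDr.
    rewrite -!scalemxAr -!scalemxAl.
    have -> : h^T *m B *m v = g^T by rewrite /g !trmx_mul trmxK Bsym mulmxA.
    rewrite -/g.
    by rewrite !mxE -subr_ge0; congr (0 <= _); ring.
  apply/matrixP => i j; rewrite !ord1 [RHS]mxE.
  have hh := spd_ge0 h Bspd; set q := (h^T *m B *m h) 0 0 in gt hh.
  apply/eqP; apply: contraT => g0.
  (* The quadratic has its minimum at t = -g/q; the denominator q + 1 also covers q = 0 and still
     gives a negative value when g is nonzero. *)
  have := gt (- g 0 0 / (q + 1)).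
  have q1 : 0 < q + 1 by rewrite ltr_wpDl.
  have -> : 2 * (- g 0 0 / (q + 1)) * g 0 0 + (- g 0 0 / (q + 1)) ^+ 2 * q =
    - (g 0 0 ^+ 2 * ((q + 2) / (q + 1) ^+ 2)).
    by field; rewrite gt_eqF.
  rewrite oppr_ge0 leNgt mulr_gt0 //; first by rewrite exprn_even_gt0.
  by rewrite divr_gt0 ?exprn_gt0 // ltr_wpDl.
have [c vc] := submx_of_null orth.
exists (- c^T); rewrite -mulmxA mulmxN -trmx_mul -vc trmx_mul trmxK Bsym.
by rewrite mulmxN mulKmx ?spd_unitmx // vE opprB.
Qed.

End BProjection.

Lemma psd_sqrtP (R : realType) n (B : 'M[R]_n) : psd_sqrt B = 0 \/
  ((psd_sqrt B)^T = psd_sqrt B /\ psd_sqrt B *m psd_sqrt B = B).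
Proof.
rewrite /psd_sqrt; case: xgetP => [X _ [Xsym _ XX]|_]; [by right|by left].
Qed.

(** A singular matrix is its own [invmx]; if 0 is a unit, then 1 = 0 and all matrices coincide. *)
Lemma invmx0 (R : comUnitRingType) n : invmx (0 : 'M[R]_n) = 0.
Proof.
rewrite /invmx; case: ifP => // /mulVmx; rewrite mulmx0 => E.
by rewrite -[LHS]mulmx1 -E mulmx0.
Qed.

(** * The mean of Z and the spectrum of W *)

Section MeanZ.
Context {R : realType} {m n : nat}.
Variables (A : 'M[R]_(m, n)) (B : 'M[R]_n) (D : probability (Sk R m) R).
Hypothesis Bspd : spd B.
Hypothesis Zint : mx_integrable D (Zmat A B).

Lemma EZ_mean : EZ A B D = mx_mean D (Zmat A B).
Proof. by apply/matrixP => i j; rewrite !mxE. Qed.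

Lemma EZ_tr : (EZ A B D)^T = EZ A B D.
Proof.
rewrite EZ_mean -mx_mean_tr; congr mx_mean; apply/funext => s.
by have [] := Zmat_oblique A s Bspd.
Qed.

Lemma EZ_ge0 (v : 'cV[R]_n) : 0 <= (v^T *m EZ A B D *m v) 0 0.
Proof.
have [_ <-] := mx_mean_qform v Zint; apply: Rintegral_ge0 => s _.
by have [Zs ZZ] := Zmat_oblique A s Bspd; exact: (oblique_qform_ge0 Bspd Zs ZZ).
Qed.

Lemma EZ_le (v : 'cV[R]_n) : (v^T *m EZ A B D *m v) 0 0 <= (v^T *m B *m v) 0 0.
Proof.
have [Zi <-] := mx_mean_qform v Zint.
have [Bi BE] := mx_mean_cst D (v^T *m B *m v).
rewrite -[in leRHS]BE mxE; apply: le_Rintegral => //.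
move=> s _; have [Zs ZZ] := Zmat_oblique A s Bspd.
exact: (oblique_qform_le Bspd Zs ZZ).
Qed.

Hypothesis sqrt_sym : (psd_sqrt B)^T = psd_sqrt B.
Hypothesis sqrt_sqr : psd_sqrt B *m psd_sqrt B = B.

Lemma psd_sqrt_unit : psd_sqrt B \in unitmx.
Proof.
by have := spd_unitmx Bspd; rewrite -{1}sqrt_sqr unitmx_mul => /andP[].
Qed.

Let Y := invmx (psd_sqrt B).
Let Ysym : Y^T = Y. Proof. by rewrite trmx_inv sqrt_sym. Qed.

Lemma invmx_sqrt_sqr : Y *m Y = invmx B.
Proof. rewrite -[LHS](mulmxK (spd_unitmx Bspd)) -{1}sqrt_sqr mulmxA.
by rewrite mulmxKV ?psd_sqrt_unit // mulVmx ?psd_sqrt_unit // mul1mx. Qed.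

Lemma Wmat_tr : (Wmat A B D)^T = Wmat A B D.
Proof. by rewrite /Wmat !trmx_mul EZ_tr -/Y Ysym mulmxA. Qed.

(** Rayleigh quotient: for a row eigenvector r and v = B^(-1/2) r^T, a |r|^2 = v^T E[Z] v and |r|^2
    = v^T B v, so the bounds 0 <= E[Z] <= B apply. *)
Lemma Wmat_eig a : eigenvalue (Wmat A B D) a -> 0 <= a <= 1.
Proof.
move=> /eigenvalueP [r rW r0]; pose v := r^T.
have vv : 0 < (r *m r^T) 0 0.
  rewrite mxE lt_neqAle eq_sym; apply/andP; split; last first.
    by apply: sumr_ge0 => i _; rewrite mxE -expr2 sqr_ge0.
  apply: contra r0; rewrite psumr_eq0; last first.
    by move=> i _; rewrite mxE -expr2 sqr_ge0.
  move=> /allP r0; apply/eqP/rowP => i; have := r0 i (mem_index_enum _).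
  by rewrite !mxE -expr2 sqrf_eq0 => /eqP.
have E : a * (r *m r^T) 0 0 = ((Y *m r^T)^T *m EZ A B D *m (Y *m r^T)) 0 0.
  have := congr1 (fun x => (x *m r^T) 0 0) rW.
  rewrite -scalemxAl [in RHS]mxE => <-.
  by rewrite /Wmat -/Y trmx_mul trmxK Ysym !mulmxA.
have E1 : (r *m r^T) 0 0 = ((Y *m r^T)^T *m B *m (Y *m r^T)) 0 0.
  rewrite -sqrt_sqr trmx_mul trmxK Ysym !mulmxA mulmxKV ?psd_sqrt_unit //.
  by rewrite mulmxK ?psd_sqrt_unit.
apply/andP; split; first by rewrite -(pmulr_lge0 _ vv) E EZ_ge0.
by rewrite -(ler_pM2r vv) mul1r E {1}E1 EZ_le.
Qed.

End MeanZ.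

(** * Mean of the heavy-ball iterates *)

Section MxMeasurable.
Context {d : measure_display} {T : measurableType d} {R : realType}.

Definition mx_measurable p q (X : T -> 'M[R]_(p, q)) : Prop :=
  forall i j, measurable_fun setT (fun w => X w i j).

Lemma mx_measurableM p q r (X : T -> 'M[R]_(p, q)) (Y : T -> 'M[R]_(q, r)) :
  mx_measurable X -> mx_measurable Y -> mx_measurable (fun w => X w *m Y w).
Proof.
move=> mX mY i j; under eq_fun do rewrite mxE.
by apply: measurable_sum => k; exact: measurable_funM.
Qed.

Lemma mx_measurableB p q (X Y : T -> 'M[R]_(p, q)) :
  mx_measurable X -> mx_measurable Y -> mx_measurable (fun w => X w - Y w).
Proof.
move=> mX mY i j; under eq_fun do rewrite !mxE.
exact: measurable_funB.
Qed.

Lemma mx_measurableZ p q (c : R) (X : T -> 'M[R]_(p, q)) :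
  mx_measurable X -> mx_measurable (fun w => c *: X w).
Proof. by move=> mX i j; under eq_fun do rewrite mxE; exact: measurable_funM. Qed.

End MxMeasurable.

Section HeavyBallMean.
Context {R : realType} {m n : nat} {d : measure_display}
  {Omega : measurableType d}.
Variables (A : 'M[R]_(m, n)) (b : 'cV[R]_m) (B : 'M[R]_n)
  (P : probability Omega R) (D : probability (Sk R m) R)
  (Sq : nat -> Omega -> Sk R m) (om beta : R) (x0 x1 xstar : 'cV[R]_n).
Hypothesis Axstar : A *m xstar = b.

Definition hb_error (k : nat) (w : Omega) : 'cV[R]_n :=
  hb_iter A b B Sq om beta x0 x1 k w - xstar.

(** As A xstar = b, the residual at v is A (v - xstar), so the affine gradient becomes linear in the
    error. *)
Lemma hb_errorSS k : hb_error k.+2 = fun w =>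
  (1 + beta) *: hb_error k.+1 w
  - om *: (invmx B *m (Zmat A B (Sq k.+1 w) *m hb_error k.+1 w))
  - beta *: hb_error k w.
Proof.
apply/funext => w; rewrite /hb_error /hb_iter /=.
case: (hb_pair A b B Sq om beta x0 x1 k w) => u v /=.
have -> : gradf A b B (Sq k.+1 w) v =
    invmx B *m (Zmat A B (Sq k.+1 w) *m (v - xstar)).
  by rewrite /gradf /Zmat -Axstar -mulmxBr !mulmxA.
set g := invmx B *m _; apply/matrixP => i j; rewrite !mxE; ring.
Qed.

Hypothesis Zint : mx_integrable D (Zmat A B).
Hypothesis Siid : iid_with_law P D Sq.

(** The k-th iterate is built from samples of index below k. [N] stays fixed in the induction, so
    both preceding errors are measurable for the same sigma-algebra. *)
Lemma hb_error_history N k : (k <= N)%N ->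
  mx_measurable (T := g_sigma_algebraType (history Sq N)) (hb_error k).
Proof.
have mZ : mx_measurable (Zmat A B).
  by move=> i j; apply/measurable_EFinP; exact: measurable_int (Zint i j).
have mcst p q (C : 'M[R]_(p, q)) :
    mx_measurable (T := g_sigma_algebraType (history Sq N)) (fun=> C).
  by move=> i j; exact: measurable_cst.
elim/ltn_ind: k => -[|[|k]] IHk kN.
- exact: (mcst _ _ (x0 - xstar)).
- exact: (mcst _ _ (x1 - xstar)).
rewrite hb_errorSS.
have [IH0 IH1] := (IHk k (leqnSn _) (ltnW (ltnW kN)),
  IHk k.+1 (leqnn _) (ltnW kN)).
pose H := g_sigma_algebraType (history Sq N).
have mZS : @mx_measurable _ H _ _ _ (fun w => Zmat A B (Sq k.+1 w)).
  move=> i j; apply: (@measurableT_comp _ _ _ H _ _ (fun s => Zmat A B s i j)).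
    exact: mZ.
  exact: history_measurable.
have mZE := mx_measurableM (mcst _ _ (invmx B)) (mx_measurableM mZS IH1).
apply: (@mx_measurableB _ H _ _ _ _ _ _ (mx_measurableZ beta IH0)).
exact: (@mx_measurableB _ H _ _ _ _ _ (mx_measurableZ (1 + beta) IH1)
  (mx_measurableZ om mZE)).
Qed.

(** Integrability and mean are obtained together, since integrability of the product of Z and the
    error itself comes from independence. *)
Lemma hb_error_integrable_mean k :
  mx_integrable P (hb_error k) -> mx_integrable P (hb_error k.+1) ->
  mx_integrable P (hb_error k.+2) /\
  mx_mean P (hb_error k.+2) = (1 + beta) *: mx_mean P (hb_error k.+1)
    - om *: (invmx B *m (EZ A B D *m mx_mean P (hb_error k.+1)))
    - beta *: mx_mean P (hb_error k).
Proof.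
move=> int0 int1; have [mS SD indepS] := Siid.
have [ZSint ZSE] := mx_mean_law (mS k.+1) (SD k.+1) Zint.
have [ZEint ZEE] : mx_integrable P
      (fun w => Zmat A B (Sq k.+1 w) *m hb_error k.+1 w) /\
    mx_mean P (fun w => Zmat A B (Sq k.+1 w) *m hb_error k.+1 w) =
      EZ A B D *m mx_mean P (hb_error k.+1).
  rewrite EZ_mean -ZSE; apply: mx_mean_indepM => // i l j.
  have mZ : measurable_fun setT (fun s => Zmat A B s i l).
    by apply/measurable_EFinP; exact: measurable_int (Zint i l).
  exact: (history_indep_pair mS indepS mZ (hb_error_history (leqnn k.+1) l j)).
have [BZEint BZEE] := mx_meanMl (invmx B) ZEint.
have [oint oE] := mx_meanZ om BZEint.
have [aint aE] := mx_meanZ (1 + beta) int1.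
have [abint abE] := mx_meanB aint oint.
have [bint bE] := mx_meanZ beta int0.
have [rint rE] := mx_meanB abint bint.
rewrite hb_errorSS.
by split=> //; rewrite rE abE aE oE BZEE ZEE bE.
Qed.

Lemma hb_error_integrable k :
  mx_integrable P (hb_error k) /\ mx_integrable P (hb_error k.+1).
Proof.
elim: k => [|k [int0 int1]].
  by split; [have [] := mx_mean_cst P (x0 - xstar)
           | have [] := mx_mean_cst P (x1 - xstar)].
by split=> //; have [] := hb_error_integrable_mean int0 int1.
Qed.

Lemma hb_error_mean_rec k :
  mx_mean P (hb_error k.+2) = (1 + beta) *: mx_mean P (hb_error k.+1)
    - om *: (invmx B *m (EZ A B D *m mx_mean P (hb_error k.+1)))
    - beta *: mx_mean P (hb_error k).
Proof.
by have [int0 int1] := hb_error_integrable k;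
  have [] := hb_error_integrable_mean int0 int1.
Qed.

End HeavyBallMean.

(** Common form of both parameter choices. The factor 99/100 gives 0 < t < s <= 1, hence (1 - s)^2 <
    (1 - t)^2 < 1. *)
Lemma params_ok_ratio (R : realType) (lmax lminp om : R) :
  0 < lminp -> 0 < om -> om <= lmax^-1 -> om * lminp <= 1 ->
  params_ok lmax lminp om ((1 - Num.sqrt (99 / 100 * (om * lminp))) ^+ 2).
Proof.
move=> lminp_gt0 om_gt0 om_le oml.
have oml_gt0 : 0 < om * lminp by rewrite mulr_gt0.
set s := Num.sqrt (om * lminp); set t := Num.sqrt (99 / 100 * _).
have s_le1 : s <= 1 by rewrite -sqrtr1 ler_sqrt.
have t_lt : t < s by rewrite /t /s ltr_sqrt //; lra.
have t_gt0 : 0 < t by rewrite sqrtr_gt0; lra.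
by split=> //; rewrite -/s; nra.
Qed.

(** * Decay of the mean error and the two parameter choices *)

Theorem mainTheorem4 (R : realType) (m n : nat)
  (A : 'M[R]_(m, n)) (b : 'cV[R]_m) (B : 'M[R]_n)
  (d : measure_display) (Omega : measurableType d) (P : probability Omega R)
  (D : probability (Sk R m) R) (Sq : nat -> Omega -> Sk R m)
  (x0 x1 xstar : 'cV[R]_n) (lmax lminp : R) :
  (* the system A x = b is consistent *)
  (exists x : 'cV[R]_n, A *m x = b) ->
  (* B is symmetric positive definite *)
  spd B ->
  (* E[Z] is finite *)
  (forall i j, D.-integrable setT (fun s => (Zmat A B s i j)%:E)) ->
  (* S_k i.i.d. ~ D *)
  iid_with_law P D Sq ->
  (* exactness: Null(E[Z]) = Null(A) *)
  (forall v : 'cV[R]_n, EZ A B D *m v = 0 <-> A *m v = 0) ->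
  A != 0 ->
  (* x^0 - x^1 in Range(B^{-1} A^T) *)
  (exists y : 'cV[R]_m, x0 - x1 = invmx B *m A^T *m y) ->
  (* x* = Pi_{L,B}(x^0) *)
  (A *m xstar = b /\
   forall x' : 'cV[R]_n, A *m x' = b -> bnorm B (xstar - x0) <= bnorm B (x' - x0)) ->
  (* lmax = largest eigenvalue of W *)
  (eigenvalue (Wmat A B D) lmax /\
   forall a, eigenvalue (Wmat A B D) a -> a <= lmax) ->
  (* lminp = smallest nonzero eigenvalue of W *)
  (eigenvalue (Wmat A B D) lminp /\ lminp != 0 /\
   forall a, eigenvalue (Wmat A B D) a -> a != 0 -> lminp <= a) ->
  (forall om beta : R, params_ok lmax lminp om beta ->
     exists C : R, 0 < C /\
       forall k : nat,
         bnorm B (Evec P (fun w => hb_iter A b B Sq om beta x0 x1 k w - xstar)) ^+ 2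
           <= beta ^+ k * C)
  /\ params_ok lmax lminp 1 ((1 - Num.sqrt ((99 / 100) * lminp)) ^+ 2)
  /\ params_ok lmax lminp lmax^-1
       ((1 - Num.sqrt ((99 / 100) * lminp / lmax)) ^+ 2).
Proof.
move=> _ Bspd Zint Siid exact _ [c1 x01] [Axstar xmin]
  [lmax_eig lmax_max] [lminp_eig [lminp0 lminp_min]].
(* If B had no square root, psd_sqrt B and hence W would be 0, contradicting
   lminp != 0; so the existence of B^(1/2) need not be proved. *)
have [sqrt0|[sqrt_sym sqrt_sqr]] := psd_sqrtP B.
  move: lminp_eig; rewrite /Wmat sqrt0 invmx0 mulmx0.
  move=> /eigenvalueP [v]; rewrite mulmx0 => /esym/eqP.
  by rewrite scaler_eq0 (negbTE lminp0) => /= ->.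
have Weig := Wmat_eig Bspd Zint sqrt_sym sqrt_sqr.
have Wsym := Wmat_tr A D Bspd sqrt_sym.
have Xunit := psd_sqrt_unit Bspd sqrt_sqr.
have YY := invmx_sqrt_sqr Bspd sqrt_sqr.
have lminp_gt0 : 0 < lminp.
  by rewrite lt_neqAle eq_sym lminp0; have /andP[] := Weig _ lminp_eig.
have lminp_le : lminp <= lmax by exact: lmax_max.
have lmax_gt0 : 0 < lmax := lt_le_trans lminp_gt0 lminp_le.
have /andP[_ lmax_le1] := Weig _ lmax_eig.
have ratio_le1 : lmax^-1 * lminp <= 1 by rewrite mulrC ler_pdivrMr // mul1r.
split; last first.
  (* The choice om = 1 is admissible because lmax <= 1. *)
  split.
    have := @params_ok_ratio R lmax lminp 1 lminp_gt0 ltr01.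
    rewrite mul1r; apply; first by rewrite invf_ge1.
    exact: le_trans lmax_le1.
  have := @params_ok_ratio R lmax lminp lmax^-1 lminp_gt0.
  rewrite -[in X in _ -> X]mulrA [lminp / lmax]mulrC.
  by apply; rewrite ?invr_gt0.
move=> om beta [om_gt0 om_le beta_gt beta_lt1].
set W := Wmat A B D in Weig Wsym lmax_max lminp_min *.
set X := psd_sqrt B in sqrt_sym sqrt_sqr Xunit YY.
pose Y := invmx X.
pose e := hb_error A b B Sq om beta x0 x1 xstar.
pose y k := X *m mx_mean P (e k).
have om_lmax : om * lmax <= 1 by rewrite -ler_pdivlMr // div1r.
have om_lminp : om * lminp <= 1.
  by apply: le_trans om_lmax; rewrite ler_pM2l.
(* If W v = 0, then E[Z] Y v = X W v = 0, and exactness gives A Y v = 0; hence the rows of A Y are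
   combinations of those of W. *)
have [K YAK] : exists K, A *m Y = K *m W.
  apply: submx_of_null => v Wv; rewrite -mulmxA; apply/exact.
  transitivity (X *m (W *m v)); last by rewrite Wv mulmx0.
  by rewrite /W /Wmat -/X -/Y !mulmxA mulmxV // mul1mx.
(* B^(1/2) B^-1 A^T = Y A^T, which is W K^T by transposing A Y = K W. *)
have range_W (c : 'cV[R]_m) : exists u, X *m (invmx B *m A^T *m c) = W *m u.
  exists (K^T *m c); rewrite -YY -/Y !mulmxA mulmxV // mul1mx.
  have -> : Y *m A^T = W *m K^T; last by [].
  apply: trmx_inj; rewrite trmx_mul (trmx_mul W) !trmxK Wsym -YAK.
  by rewrite trmx_inv sqrt_sym.
have [c0 x0star] := projection_range Bspd Axstar xmin.
have yrec k : y k.+2 =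
    (1 + beta) *: y k.+1 - om *: (W *m y k.+1) - beta *: y k.
  rewrite /y (hb_error_mean_rec om beta x0 x1 Axstar Zint Siid).
  rewrite !mulmxBr -!scalemxAr; congr (_ - _ *: _ - _).
  by rewrite /W /Wmat -/X -/Y -YY -/Y !mulmxA mulmxV // mul1mx mulmxKV.
(* Two consecutive indices are carried because the recursion has order two. *)
have y_range k : (exists u, y k = W *m u) /\ (exists u, y k.+1 = W *m u).
  elim: k => [|k [[u0 yu0] [u1 yu1]]].
    have m0 : mx_mean P (e 0%N) = x0 - xstar := (mx_mean_cst P (x0 - xstar)).2.
    have m1 : mx_mean P (e 1%N) = x1 - xstar := (mx_mean_cst P (x1 - xstar)).2.
    split; rewrite /y ?m0 ?m1; first by rewrite x0star; exact: range_W.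
    have -> : x1 - xstar = invmx B *m A^T *m (c0 - c1).
      by rewrite mulmxBr -x0star -x01 opprB [RHS]addrC addrA subrK.
    exact: range_W.
  split; first by exists u1.
  exists ((1 + beta) *: u1 - om *: (W *m u1) - beta *: u0).
  by rewrite yrec yu0 yu1 !mulmxBr -!scalemxAr.
have [C [C_gt0 CP]] := heavy_ball_decay Wsym lminp_gt0
  (fun a ea a0 => introT andP (conj (lminp_min a ea a0) (lmax_max a ea)))
  om_gt0 om_lmax om_lminp beta_gt beta_lt1 (fun k => (y_range k).1) yrec.
exists C; split=> // k; apply: le_trans (CP k).
rewrite bnorm_sqr //.
have -> : Evec P (fun w => hb_iter A b B Sq om beta x0 x1 k w - xstar) =
    mx_mean P (e k).
  by apply/matrixP => i j; rewrite !mxE unlock !ord1.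
by rewrite /dotv /y trmx_mul sqrt_sym -[in leLHS]sqrt_sqr !mulmxA.
Qed.
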